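(* There is a constant $c>0$ and a family of critical graphs containing no triangles and no pentagons (i.e. no odd cycles of length $3$ or $5$), whose members have unbounded chromatic number and each member on $n$ vertices has more than $cn^2$ edges. In particular, the density constants satisfy $c_{5,4}\geq \frac{1}{36}$, $c_{5,5}\geq \frac{3}{35}$, and $c_{5,k}=\frac14$ for all $k\geq 6$.
   Context: A graph is $k$-critical if it has chromatic number $k$ and removing any edge allows it to be properly $(k-1)$-colored; a graph is critical if it is $k$-critical for some $k$. The odd-girth of a graph is the length of a shortest odd cycle. For integers $\ell\geq 3$, $k\geq 4$, the density constant $c_{\ell,k}$ is the supremum of the constants $c$ such that there are infinitely many $k$-critical graphs of odd-girth $>\ell$, each having more than $cn^2$ edges, where $n$ is its number of vertices. *)

(* Defs.v *)
From HB Require Import structures.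
From mathcomp Require Import all_boot all_order all_algebra.
From mathcomp Require Import classical_sets reals.
Set Implicit Arguments. Unset Strict Implicit. Unset Printing Implicit Defensive.
Import Order.TTheory GRing.Theory Num.Theory.

Record sgraph := SGraph {
  nverts : nat;
  adj : rel 'I_nverts;
  adj_sym : symmetric adj;
  adj_irrefl : irreflexive adj
}.
Arguments adj : clear implicits.

Definition nedges (G : sgraph) : nat :=
  #|[set p : 'I_(nverts G) * 'I_(nverts G) | (p.1 < p.2)%N && adj G p.1 p.2]|.

Definition colorable_rel (n : nat) (e : rel 'I_n) (k : nat) : Prop :=
  exists f : 'I_n -> 'I_k, forall x y, e x y -> f x != f y.

Definition colorable (G : sgraph) (k : nat) : Prop := colorable_rel (adj G) k.

Definition chromatic_number_is (G : sgraph) (k : nat) : Prop :=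
  colorable G k /\ forall j, (j < k)%N -> ~ colorable G j.

Definition remove_edge (G : sgraph) (x y : 'I_(nverts G)) : rel 'I_(nverts G) :=
  fun u v => adj G u v && ~~ (((u == x) && (v == y)) || ((u == y) && (v == x))).

Definition k_critical (G : sgraph) (k : nat) : Prop :=
  chromatic_number_is G k /\
  forall x y, adj G x y -> colorable_rel (remove_edge x y) k.-1.

Definition is_cycle (G : sgraph) (s : seq 'I_(nverts G)) : bool :=
  [&& (3 <= size s)%N, uniq s & cycle (adj G) s].

Definition odd_girth_gt (G : sgraph) (l : nat) : Prop :=
  forall s : seq 'I_(nverts G), is_cycle s -> odd (size s) -> (l < size s)%N.

Local Open Scope ring_scope.
(* There are infinitely many k-critical graphs of odd girth > l with more
   than c n^2 edges (infinitely many = arbitrarily large vertex count). *)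
Definition dense_critical (R : realType) (l k : nat) (c : R) : Prop :=
  forall N : nat, exists G : sgraph,
    [/\ (N <= nverts G)%N, k_critical G k, odd_girth_gt G l &
        c * ((nverts G) ^ 2)%:R < (nedges G)%:R].

Definition density_const (R : realType) (l k : nat) : R :=
  sup [set c : R | dense_critical l k c].

(* Main.v *)
(** Let B and C be independent sets joined completely, and force by small gadgets
    that colour 0 occurs on B and on C, while the other colours allowed on B and on C
    are disjoint.  The result is not K-colourable.  If every single vertex of B (of C)
    can be the only one of its set with colour 0, then deleting any B-C edge gives a
    K-colouring, so every (K+1)-critical subgraph contains all B-C edges.

    Lists of allowed colours cost only a bounded number of extra vertices: take the
    categorical product of K_K with a graph that is not K-colourable.  In a proper
    K-colouring some row {g} x K_K of it is rainbow (Greenwell and Lovász), and the same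
    permutation of colours then appears in all rows connected to g.

    All graphs below are mapped homomorphically to the graph on triples a < b < c of
    naturals in which (a, b, c) is adjacent to (b, c, d).  This graph has unbounded
    chromatic number and no closed walk of length 5, hence no triangle or pentagon is
    ever created.

    The basic gadget is an odd cycle with pendant vertices whose lists force one of the
    pendant vertices to take a prescribed colour p; B is either matched to the pendant
    vertices, or indexed by pairs of pendant vertices of two gadgets.  In the second case
    the gadget has size O(sqrt |B|), but B uses three colours.  Two matched sides give
    4-critical graphs of density 1/36, a product side and a matched side give 5-critical
    graphs of density 1/10 (more than 3/35), and two product sides give density 1/4
    for all larger k. *)
Require Import Defs.
From HB Require Import structures.
From mathcomp Require Import classical_sets reals.
From mathcomp Require Import all_boot all_order all_algebra.
From mathcomp Require Import zify ring lra.
Import Order.TTheory GRing.Theory Num.Theory.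
Set Implicit Arguments. Unset Strict Implicit. Unset Printing Implicit Defensive.

(** * Critical subgraphs and Mantel's bound *)

Definition proper_coloring (T : Type) (C : eqType) (e : rel T) (f : T -> C) :=
  forall x y, e x y -> f x != f y.

(** Walks rather than cycles: the condition pulls back along homomorphisms, and it excludes loops,
    triangles and pentagons at once. *)
Definition no_closed_5walk (T : Type) (e : rel T) := forall x1 x2 x3 x4 x5,
  e x1 x2 -> e x2 x3 -> e x3 x4 -> e x4 x5 -> e x5 x1 -> False.

Lemma no5_irrefl (T : Type) (e : rel T) : no_closed_5walk e -> irreflexive e.
Proof. by move=> e5 x; apply/negP=> exx; exact: (e5 x x x x x). Qed.

Lemma no5_triangle (T : Type) (e : rel T) x y z : symmetric e ->
  no_closed_5walk e -> e x y -> e y z -> e z x -> False.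
Proof. by move=> eC e5 xy yz zx; apply: (e5 x y z x y); rewrite // eC. Qed.

Lemma odd_girth_gt5 (G : sgraph) : no_closed_5walk (adj G) -> odd_girth_gt G 5.
Proof.
move=> e5 [|a [|b [|c [|d [|x [|y s]]]]]] //=; case/and3P => _ _ /=.
  by move/and4P=> [ab bc ca _] _; case: (no5_triangle (@adj_sym G) e5 ab bc ca).
by case/and5P=> ab bc cd dx /andP[xa _] _; case: (e5 a b c d x).
Qed.

Definition adjset (T : finType) (e : rel T) : {set T * T} := [set p | e p.1 p.2].

Lemma card_adjset (G : sgraph) : #|adjset (adj G)| = (nedges G).*2.
Proof.
set A := [set p : 'I_(nverts G) * 'I_(nverts G) | (p.1 < p.2)%N && adj G p.1 p.2].
have -> : adjset (adj G) = A :|: [set (p.2, p.1) | p in A].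
  apply/setP=> -[x y]; rewrite !inE /=; apply/idP/orP.
    move=> xy; case: (ltngtP x y) => [lt|lt|eqxy]; first by left.
      by right; apply/imsetP; exists (y, x); rewrite // inE /= lt adj_sym.
    by move: xy; rewrite (val_inj eqxy) adj_irrefl.
  case=> [/andP[]//|/imsetP[[u v]]]; rewrite inE /= => /andP[_ uv] [-> ->].
  by rewrite adj_sym.
rewrite cardsU card_imset; last by move=> [a b] [c d] [-> ->].
rewrite (_ : _ :&: _ = set0) ?cards0 ?subn0 ?addnn //.
apply/setP=> -[x y]; rewrite !inE /=; apply/negP=> /andP[/andP[xy _]].
by case/imsetP=> -[u v]; rewrite inE /= => /andP[uv _] [xv yu]; subst; lia.
Qed.

(** An inclusion-minimal edge set among the symmetric ones that are not K-colourable; boolean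
    versions of both properties make [minset_exists] applicable. *)
Lemma edge_minimal_subgraph (T : finType) (e : rel T) (K : nat) : symmetric e ->
  (forall f : T -> 'I_K, ~ proper_coloring e f) ->
  exists e' : rel T, [/\ symmetric e', subrel e' e,
    (forall f : T -> 'I_K, ~ proper_coloring e' f) &
    forall d : rel T, symmetric d -> subrel d e' ->
      (exists x y, e' x y && ~~ d x y) -> exists f : T -> 'I_K, proper_coloring d f].
Proof.
move=> eC ne.
pose symb (E : {set T * T}) := [forall x, forall y, ((x, y) \in E) == ((y, x) \in E)].
pose colb (E : {set T * T}) :=
  [exists f : {ffun T -> 'I_K}, forall x, forall y, ((x, y) \in E) ==> (f x != f y)].
have symP (E : {set T * T}) : reflect (forall x y, ((x, y) \in E) = ((y, x) \in E)) (symb E).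
  apply: (iffP forallP) => [h x y|h x].
    by apply/eqP; move/forallP: (h x).
  by apply/forallP=> y; apply/eqP.
have colP (E : {set T * T}) : reflect (exists f : T -> 'I_K, forall x y, (x, y) \in E -> f x != f y) (colb E).
  apply: (iffP existsP) => -[f hf].
    by exists f => x y; move/forallP/(_ x)/forallP/(_ y)/implyP: hf.
  exists (finfun f); apply/forallP=> x; apply/forallP=> y; apply/implyP.
  by rewrite !ffunE; apply: hf.
pose P E := symb E && ~~ colb E.
have P0 : P (adjset e).
  apply/andP; split; first by apply/symP=> x y; rewrite !inE /= eC.
  apply/colP=> -[f hf]; apply: (ne f) => x y exy.
  by apply: hf; rewrite inE.
have [E /minsetP[/andP[Es En] Emin] sEe] := minset_exists P0.
exists (fun x y => (x, y) \in E); split.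
- by move=> x y; apply: (symP _ Es).
- by move=> x y xyE; move/subsetP/(_ _ xyE): sEe; rewrite inE.
- by move=> f hf; move/colP: En; apply; exists f.
move=> d dC dE [x [y /andP[xyE ndxy]]].
have sdE : adjset d \subset E by apply/subsetP=> -[u v]; rewrite inE /=; exact: dE.
have : ~~ P (adjset d).
  apply/negP=> Pd; have dEE := Emin _ Pd sdE.
  by move: ndxy; rewrite -dEE inE /= in xyE; rewrite xyE.
rewrite negb_and negbK => /orP[/symP[]|/colP[f hf]].
  by move=> u v; rewrite !inE /= dC.
by exists f => u v duv; apply: hf; rewrite inE.
Qed.

Lemma chromatic_of_edge_removal (G : sgraph) (K : nat) :
  (forall f : 'I_(nverts G) -> 'I_K, ~ proper_coloring (adj G) f) ->
  (exists x y, adj G x y) ->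
  (forall x y, adj G x y -> colorable_rel (remove_edge x y) K) ->
  k_critical G K.+1.
Proof.
move=> nG [x0 [y0 xy0]] rm; split=> //; split.
  have [f hf] := rm _ _ xy0.
  (* A K-colouring without the edge x0 y0 becomes a proper (K+1)-colouring when x0 receives the new
     colour. *)
  exists (fun v => if v == x0 then ord_max else widen_ord (leqnSn K) (f v)) => u v uv.
  have unev : u != v by apply: contraTneq uv => ->; rewrite adj_irrefl.
  case: (altP (u =P x0)) => [ux|ux]; case: (altP (v =P x0)) => [vx|vx].
  - by rewrite ux vx eqxx in unev.
  - by apply/eqP=> /(congr1 val) /= h; have := ltn_ord (f v); lia.
  - by apply/eqP=> /(congr1 val) /= h; have := ltn_ord (f u); lia.
  have: f u != f v by apply: hf; rewrite /remove_edge uv (negPf ux) (negPf vx) andbF.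
  by apply: contraNneq => /(congr1 val)/= h; apply/eqP/val_inj.
move=> j jK [f hf]; have jK' : (j <= K)%N by [].
apply: (nG (fun v => widen_ord jK' (f v))) => u v uv.
by have := hf _ _ uv; apply: contraNneq => /(congr1 val)/= h; apply/eqP/val_inj.
Qed.

(* The subgraph keeps the vertex set of [e], possibly with isolated vertices. *)
Lemma critical_subgraph (T : finType) (e : rel T) (K : nat) (D : {set T * T}) :
  symmetric e -> no_closed_5walk e ->
  (forall f : T -> 'I_K, ~ proper_coloring e f) ->
  D != set0 ->
  (forall x y, (x, y) \in D -> (y, x) \notin D) ->
  (forall x y, (x, y) \in D -> e x y /\ exists f : T -> 'I_K,
     forall u v, e u v -> f u = f v -> (u, v) = (x, y) \/ (u, v) = (y, x)) ->
  exists G, [/\ nverts G = #|T|, k_critical G K.+1, odd_girth_gt G 5 & (#|D| <= nedges G)%N].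
Proof.
move=> eC e5 ne D0 Das Dcrit.
have [e' [e'C e'e ne' e'min]] := edge_minimal_subgraph eC ne.
have De' x y : (x, y) \in D -> e' x y.
  move=> xyD; have [_ [f hf]] := Dcrit _ _ xyD.
  (* If the edge xy were missing from [e'], the colouring whose only monochromatic edge is xy would
     be proper on [e']. *)
  apply/negPn/negP => nxy; apply: (ne' f) => u v uv; apply/eqP=> fuv.
  have [[eu ev]|[eu ev]] := hf _ _ (e'e _ _ uv) fuv; move: uv; rewrite eu ev.
    by rewrite (negPf nxy).
  by rewrite e'C (negPf nxy).
have e'5 : no_closed_5walk e'.
  by move=> x1 x2 x3 x4 x5 *; apply: (e5 x1 x2 x3 x4 x5); exact: e'e.
pose a : rel 'I_#|T| := fun i j => e' (enum_val i) (enum_val j).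
have aC : symmetric a by move=> i j; exact: e'C.
have a5 : no_closed_5walk a.
  by move=> x1 x2 x3 x4 x5; rewrite /a; exact: e'5.
pose G := SGraph aC (no5_irrefl a5).
have DG : (#|D| <= nedges G)%N.
  have sw : injective (fun p : T * T => (p.2, p.1)) by move=> [? ?] [? ?] [-> ->].
  pose D2 := D :|: [set (p.2, p.1) | p in D].
  have cD2 : #|D2| = #|D|.*2.
    rewrite cardsU card_imset // (_ : _ :&: _ = set0) ?cards0 ?subn0 ?addnn //.
    apply/setP=> -[x y]; rewrite !inE; apply/negP=> /andP[xy /imsetP[[u v] uv [xv yu]]].
    by move: xy (Das _ _ uv); rewrite xv yu => ->.
  rewrite -leq_double -card_adjset -cD2.
  pose r (p : T * T) : 'I_#|T| * 'I_#|T| := (enum_rank p.1, enum_rank p.2).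
  have rI : injective r by move=> [? ?] [? ?] [/enum_rank_inj -> /enum_rank_inj ->].
  rewrite -(card_imset _ rI); apply/subset_leq_card/subsetP=> q /imsetP[[x y]].
  rewrite !inE => xyD ->; rewrite /= /a !enum_rankK.
  case/orP: xyD => [|/imsetP[[u v] uv [-> ->]]]; first exact: De'.
  by rewrite e'C; apply: De'.
exists G; split=> //; last exact: odd_girth_gt5.
have remG x y : adj G x y -> colorable_rel (@remove_edge G x y) K.
  move=> /= axy.
  pose d : rel T := fun u v =>
    e' u v && ~~ (((u == enum_val x) && (v == enum_val y)) || ((u == enum_val y) && (v == enum_val x))).
  have [||| f hf] := e'min d.
  - by move=> u v; rewrite /d e'C orbC ![(v == _) && _]andbC.
  - by move=> u v /andP[].
  - by exists (enum_val x), (enum_val y); rewrite /d !eqxx /= andbF andbT.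
  exists (fun i => f (enum_val i)) => u v uv; apply: hf.
  by move: uv; rewrite /remove_edge /d /= !(inj_eq enum_val_inj).
apply: chromatic_of_edge_removal => //.
- move=> f hf; apply: (ne' (fun x => f (enum_rank x))) => x y xy.
  by apply: hf; rewrite /= /a !enum_rankK.
have [[x y] xyD] := set0Pn _ D0.
by exists (enum_rank x), (enum_rank y); rewrite /= /a !enum_rankK; exact: De'.
Qed.

(** Let x have maximal degree d. Its neighbourhood is independent, so every edge has an end outside
    it, and there are at most (n - d) d edges. *)
Lemma mantel (G : sgraph) : odd_girth_gt G 5 -> (4 * nedges G <= nverts G ^ 2)%N.
Proof.
move=> og; have tri x y z : adj G x y -> adj G y z -> adj G z x -> False.
  move=> xy yz zx; have /= := og [:: x; y; z]; rewrite /is_cycle /= xy yz zx !inE.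
  have ne u v : adj G u v -> (u == v) = false.
    by move=> uv; apply: contraTF uv => /eqP->; rewrite adj_irrefl.
  by rewrite (ne _ _ xy) (ne _ _ yz) eq_sym (ne _ _ zx) /=; move/(_ isT isT).
have [n0|/card_gt0P[v0 _]] := posnP #|'I_(nverts G)|.
  have := leq_imset_card; have := card_adjset G.
  have -> : #|adjset (adj G)| = 0.
    by apply: eq_card0 => -[x y]; have := fintype0 x n0.
  lia.
pose N x := [set y | adj G x y].
pose x := [arg max_(x > v0) #|N x|].
have xmax v : (#|N v| <= #|N x|)%N.
  by rewrite /x; case: arg_maxnP => // i _; apply.
set d := #|N x| in xmax.
have cC : #|~: N x| = (nverts G - d)%N by rewrite cardsCs setCK card_ord.
have dn : (d <= nverts G)%N by rewrite /d -[X in (_ <= X)%N]card_ord max_card.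
have : (nedges G <= \sum_(v in ~: N x) #|N v|)%N.
  (* [f] turns each edge so that its first end lies outside the neighbourhood of x. *)
  pose f (p : 'I_(nverts G) * 'I_(nverts G)) := if p.1 \in N x then (p.2, p.1) else p.
  set A := [set p : 'I_(nverts G) * 'I_(nverts G) | (p.1 < p.2)%N && adj G p.1 p.2].
  have fI : {in A &, injective f}.
    move=> [a b] [c e]; rewrite !inE /f /= => /andP[ab _] /andP[ce _].
    by case: ifP => _; case: ifP => _ [p1 p2]; subst => //; lia.
  rewrite /nedges -/A -(card_in_imset fI).
  have -> : (\sum_(v in ~: N x) #|N v|)%N = #|[set p | (p.1 \in ~: N x) && (p.2 \in N p.1)]|.
    rewrite -sum1_card (eq_bigl (fun p : _ * _ => (p.1 \in ~: N x) && (p.2 \in N p.1))); last by move=> p; rewrite inE.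
    rewrite -(pair_big_dep (mem (~: N x)) (fun a b => b \in N a) (fun _ _ => 1%N)) /=.
    by apply: eq_bigr => v _; rewrite sum1_card.
  apply/subset_leq_card/subsetP=> p /imsetP[[a b]]; rewrite !inE => /andP[_ /= ab] ->.
  rewrite /f inE /=; case: ifP => /= xa; rewrite ?xa //=.
  by rewrite (adj_sym b) ab andbT; apply/negP=> xb; apply: (tri x a b) => //; rewrite adj_sym.
move=> h; have : (nedges G <= (nverts G - d) * d)%N.
  apply: leq_trans h _; rewrite -cC -sum_nat_const; exact: leq_sum.
by move=> h2; rewrite -[X in (_ <= X ^ _)%N](subnK dn); apply: leq_trans (nat_AGM2 _ _); by rewrite leq_mul2l.
Qed.

(** * Labels and realization of lists *)

Definition triple : predArgType := (nat * nat * nat)%type.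

Definition sarc (s t : triple) : bool :=
  let: (a, b, c) := s in let: (b', c', d) := t in
  [&& b == b', c == c', a < b, b < c & c < d]%N.

Definition sadj (s t : triple) : bool := sarc s t || sarc t s.

(** The bounds are symmetric under x -> 17 - x, and 0 < a leaves room for one more coordinate below
    every label. *)
Definition ranged (t : triple) : bool :=
  let: (a, b, c) := t in [&& 0 < a, a < b, b < c & c < 17]%N.

Lemma sadjC : symmetric sadj.
Proof. by move=> s t; rewrite /sadj orbC. Qed.

(** Choosing a direction for each of the five steps gives 32 systems of equations and strict
    inequalities between coordinates, all contradictory. *)
Lemma sadj_no5 : no_closed_5walk sadj.
Proof.
move=> [[a1 b1] c1] [[a2 b2] c2] [[a3 b3] c3] [[a4 b4] c4] [[a5 b5] c5].
rewrite /sadj /sarc.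
by do 5 case/orP=> /and5P[/eqP ? /eqP ? ? ? ?]; lia.
Qed.

(** Pigeonhole on sets of sets of colours: [S a b] collects the colours of the triples (a, b, c),
    and [P a] collects the sets [S a b]. If P i = P j with i < j, then S i j = S j k for some k, and
    the colour of (i, j, k) recurs at some (j, k, l). *)
Lemma shift_mono_edge (K : nat) (f : triple -> 'I_K) :
  exists a b c d : nat, [/\ (a < b < c)%N, (c < d <= 2 ^ 2 ^ K)%N &
    f (a, b, c) = f (b, c, d)].
Proof.
set N := (2 ^ 2 ^ K).+1.
pose S (a b : nat) : {set 'I_K} :=
  [set i | [exists c : 'I_N, (b < c)%N && (f (a, b, val c) == i)]].
pose P (a : nat) : {set {set 'I_K}} :=
  [set s | [exists b : 'I_N, (a < b)%N && (S a b == s)]].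
have cP : #|{: {set {set 'I_K}}}| = (2 ^ 2 ^ K)%N.
  by rewrite -cardsT -powersetT card_powerset cardsT -cardsT -powersetT card_powerset cardsT card_ord.
have : ~~ injectiveb (fun i : 'I_N => P i).
  apply/injectiveP => /leq_card; rewrite cP card_ord; lia.
case/injectivePn=> i [j]; wlog ltij : i j / (i < j)%N.
  move=> wl ij eP; case: (ltngtP i j) => [lt|lt|e].
  - by apply: (wl i j).
  - by apply: (wl j i) => //; rewrite eq_sym.
  - by rewrite (val_inj e) eqxx in ij.
move=> _ ePij.
have : S i j \in P j by rewrite -ePij inE; apply/existsP; exists j; rewrite ltij eqxx.
rewrite inE => /existsP[k /andP[ltjk /eqP eS]].
have : f (val i, val j, val k) \in S j k.
  by rewrite eS inE; apply/existsP; exists k; rewrite ltjk eqxx.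
rewrite inE => /existsP[l /andP[ltkl /eqP el]].
exists i, j, k, l; split; rewrite ?ltij //.
by rewrite ltkl -ltnS ltn_ord.
Qed.
(** A proper K-colouring of the categorical product of K_K with the triples whose last coordinate is
    below M; [F t] is the row of t. *)
Definition rows_proper (K M : nat) (F : triple -> 'I_K -> 'I_K) :=
  forall s t c d, (s.2 < M)%N -> (t.2 < M)%N -> sadj s t -> c != d -> F s c != F t d.

(* Otherwise every row has a repeated colour, and mapping a triple to the repeated
   colour of its row would be a proper colouring of the triples. *)
Lemma product_row_injective (K M : nat) (F : triple -> 'I_K -> 'I_K) :
  (2 ^ 2 ^ K < M)%N -> rows_proper M F ->
  exists a b c, [/\ (a < b < c)%N, (c <= 2 ^ 2 ^ K)%N & injective (F (a, b, c))].
Proof.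
case: K F => [|K] F NM Fp.
  by exists 0, 1, 2; split=> // -[].
(* The default [ord0] is irrelevant where [phi] is used: both rows considered below have a repeated
   colour. *)
pose phi t := if [pick p | (p.1 != p.2) && (F t p.1 == F t p.2)] is Some p then F t p.1 else ord0.
have [a [b [c [d [abc cd e]]]]] := shift_mono_edge phi.
have [/injectiveP inj|/injectivePn[x1 [y1 n1 e1]]] := boolP (injectiveb (F (a, b, c))).
  by exists a, b, c; split=> //; lia.
have [/injectiveP inj|/injectivePn[x2 [y2 n2 e2]]] := boolP (injectiveb (F (b, c, d))).
  by exists b, c, d; split=> //; lia.
have ad : sadj (a, b, c) (b, c, d) by rewrite /sadj /sarc !eqxx; lia.
have cM : ((a, b, c).2 < M)%N by rewrite /=; lia.
have dM : ((b, c, d).2 < M)%N by rewrite /=; lia.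
move: e; rewrite /phi.
case: pickP => [[x y] /andP[/= nxy /eqP exy]|/(_ (x1, y1))]; last by rewrite n1 e1 eqxx.
case: pickP => [[z w] /andP[/= nzw /eqP ezw]|/(_ (x2, y2))]; last by rewrite n2 e2 eqxx.
(* Two columns x, y of one row and a column z of the adjacent row share a colour; z differs from x
   or from y, which contradicts properness. *)
move=> exz; have [xz|nxz] := eqVneq x z; last by have := Fp _ _ _ _ cM dM ad nxz; rewrite exz eqxx.
have nyz : y != z by rewrite -xz eq_sym.
by have := Fp _ _ _ _ cM dM ad nyz; rewrite -exy exz eqxx.
Qed.

(** An injective row contains every colour, so F t c occurs in row s; properness allows it only in
    column c. *)
Lemma row_eq (K M : nat) (F : triple -> 'I_K -> 'I_K) s t :
  rows_proper M F -> (s.2 < M)%N -> (t.2 < M)%N ->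
  sadj s t -> injective (F s) -> F t =1 F s.
Proof.
move=> Fp sM tM st inj c; have [g sK gK] := injF_bij inj.
have [eg|ng] := eqVneq (g (F t c)) c; first by rewrite -{2}eg gK.
by have := Fp _ _ _ _ sM tM st ng; rewrite gK eqxx.
Qed.

Section ListRealization.
Variables (K : nat) (V : finType) (e : rel V) (lab : V -> triple) (allowed : V -> seq nat).
Let N := (2 ^ 2 ^ K)%N.
Variable M : nat.
Hypothesis NM : (N + 18 <= M)%N.
Definition palette : finType := ('I_M.+1 * 'I_M.+1 * 'I_M.+1 * 'I_K)%type.
Let W := palette.
Hypothesis eC : symmetric e.
Hypothesis labe : forall u v, e u v -> sadj (lab u) (lab v).
Hypothesis labP : forall v, ranged (lab v).

Definition vlab (v : V) : triple := let: (a, b, c) := lab v in (a + N.+1, b + N.+1, c + N.+1)%N.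
Definition wlab (w : W) : triple := (val w.1.1.1, val w.1.1.2, val w.1.2).

(* A vertex v is joined to the rows adjacent to its label, at the colours it must avoid.
   Labels of V are moved above N so that all rows forced to be rainbow lie below them. *)
Definition list_adj (x y : V + W) : bool :=
  match x, y with
  | inl u, inl v => e u v
  | inl v, inr w | inr w, inl v => sadj (vlab v) (wlab w) && (val w.2 \notin allowed v)
  | inr w, inr w' => sadj (wlab w) (wlab w') && (w.2 != w'.2)
  end.

Lemma list_adjC : symmetric list_adj.
Proof. by case=> x [y|y] //=; rewrite 1?eC // sadjC eq_sym. Qed.

Lemma list_adj_no5 : no_closed_5walk list_adj.
Proof.
pose l (x : V + W) := match x with inl v => vlab v | inr w => wlab w end.
have hl x y : list_adj x y -> sadj (l x) (l y).
  case: x y => x [] y //=; try by case/andP.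
    move/labe; rewrite /vlab; case: (lab x) (lab y) => [[? ?] ?] [[? ?] ?].
    by rewrite /sadj /sarc !eqn_add2r !ltn_add2r.
  by case/andP; rewrite sadjC.
move=> x1 x2 x3 x4 x5 /hl h1 /hl h2 /hl h3 /hl h4 /hl h5.
exact: (sadj_no5 h1 h2 h3 h4 h5).
Qed.

(** The colours of a rainbow row define a permutation; undoing it turns a proper colouring into one
    in which each vertex avoids the columns outside its list. *)
Lemma list_adj_sound (F : V + W -> 'I_K) : proper_coloring list_adj F ->
  exists f : V -> nat, (forall v, f v \in allowed v) /\ proper_coloring e f.
Proof.
move=> Fp.
pose w (t : triple) (c : 'I_K) : W := (inord t.1.1, inord t.1.2, inord t.2, c).
have wK (t : triple) c : (t.1.1 < t.1.2 < t.2)%N -> (t.2 < M)%N -> wlab (w t c) = t.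
  case: t => [[a b] d] /= /andP[ab bd] => dM.
  rewrite /wlab /= !inordK //; lia.
pose R t c := F (inr (w t c)).
have Rp : rows_proper M R.
  move=> s t c d sM tM st cd; apply: Fp => /=.
  have [sl tl] : (s.1.1 < s.1.2 < s.2)%N /\ (t.1.1 < t.1.2 < t.2)%N.
    case: (s) (t) st => [[? ?] ?] [[? ?] ?] /=; rewrite /sadj /sarc.
    by case/orP=> /and5P[/eqP-> /eqP-> ? ? ?]; lia.
  by rewrite !wK // st.
have NM' : (2 ^ 2 ^ K < M)%N by rewrite -/N; lia.
have [a [b [c [/andP[ab bc] cN inj]]]] := product_row_injective NM' Rp.
have [g RK gK] := injF_bij inj.
(* Three steps lead from the rainbow row, whose coordinates are at most N, to a row adjacent to any
   shifted label (x, y, z); its permutation is carried along. *)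
have spread x y : (0 < x < y)%N -> (y < 17)%N ->
    R (N.+1, x + N.+1, y + N.+1)%N =1 R (a, b, c).
  move=> /andP[x0 xy] y17.
  have s1 : sadj (a, b, c) (b, c, N.+1) by rewrite /sadj /sarc !eqxx; lia.
  have s2 : sadj (b, c, N.+1) (c, N.+1, x + N.+1)%N by rewrite /sadj /sarc !eqxx; lia.
  have s3 : sadj (c, N.+1, x + N.+1)%N (N.+1, x + N.+1, y + N.+1)%N.
    by rewrite /sadj /sarc !eqxx; lia.
  have r1 := row_eq Rp _ _ s1 inj.
  rewrite /= in r1.
  have {}r1 : R (b, c, N.+1) =1 R (a, b, c) by apply: r1; lia.
  have inj1 : injective (R (b, c, N.+1)) by apply: eq_inj inj _ => z; rewrite r1.
  have r2 : R (c, N.+1, x + N.+1)%N =1 R (b, c, N.+1).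
    by apply: (row_eq Rp _ _ s2 inj1); rewrite /=; lia.
  have inj2 : injective (R (c, N.+1, x + N.+1)%N) by apply: eq_inj inj1 _ => z; rewrite r2.
  have r3 : R (N.+1, x + N.+1, y + N.+1)%N =1 R (c, N.+1, x + N.+1)%N.
    by apply: (row_eq Rp _ _ s3 inj2); rewrite /=; lia.
  by move=> z; rewrite r3 r2 r1.
exists (fun v => val (g (F (inl v)))); split=> [v|u v uv].
  apply: contraT => nin; set k := g _ in nin.
  have := labP v; case lv : (lab v) => [[x y] z] /= /and4P[x0 xy yz z17].
  have := Fp (inl v) (inr (w (N.+1, x + N.+1, y + N.+1)%N k)).
  rewrite /= nin andbT wK /=; [|lia|lia].
  rewrite /vlab lv -[F (inr _)]/(R _ k) spread; [|lia|lia].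
  rewrite /k gK eqxx; move/(_ _)/negP; case=> //.
  by rewrite /sadj /sarc !eqxx; lia.
apply: contraNneq (Fp (inl u) (inl v) uv) => /val_inj h.
by rewrite -[F (inl u)]gK -[F (inl v)]gK h.
Qed.

(** Each palette vertex takes its column as colour. Properness of [f] is not assumed, so colourings
    with a single bad edge extend as well. *)
Lemma list_adj_complete (f : V -> nat) :
  (forall v, f v \in allowed v) -> (forall v, f v < K)%N ->
  exists F : V + W -> 'I_K, forall x y, list_adj x y -> F x = F y ->
    exists u v, [/\ x = inl u, y = inl v & f u = f v].
Proof.
move=> fl fK; exists (fun x => match x with inl v => Ordinal (fK v) | inr w => w.2 end).
move=> [u|w] [v|w'] //=.
- by move=> _ [fuv]; exists u, v.
- by case/andP=> _ nin h; case/negP: nin; rewrite -h /= fl.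
- by case/andP=> _ nin h; case/negP: nin; rewrite h /= fl.
- by case/andP=> _ /eqP.
Qed.
End ListRealization.

(** * Joining two sides *)

Definition reflect_label (t : triple) : triple :=
  let: (a, b, c) := t in (17 - c, 17 - b, 17 - a)%N.

Lemma reflect_ranged t : ranged t -> ranged (reflect_label t).
Proof. by case: t => [[a b] c] /=; lia. Qed.

Lemma reflect_sadj s t : ranged s -> ranged t -> sadj s t ->
  sadj (reflect_label s) (reflect_label t).
Proof.
case: s t => [[a b] c] [[a' b'] c'] /= Hs Ht; rewrite /sadj /sarc.
by case/orP=> /and5P[/eqP e1 /eqP e2 *]; rewrite -?e1 -?e2 ?e1 ?e2 !eqxx; lia.
Qed.

(* [core] is a gadget forcing colour 0 on the independent set [bdry], whose vertices all
   have the list [0 :: pal]. *)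
Record side := Side {
  core : finType;
  bdry : finType;
  core_adj : rel core;
  att : core -> bdry -> bool;
  core_list : core -> seq nat;
  pal : seq nat;
  core_lab : core -> triple;
  bdry_lab : bdry -> triple }.
Arguments core_adj : clear implicits.
Arguments att : clear implicits.
Arguments core_list : clear implicits.
Arguments core_lab : clear implicits.
Arguments bdry_lab : clear implicits.

Definition side_coloring (S : side) (f : core S -> nat) (g : bdry S -> nat) :=
  [/\ forall x, f x \in core_list S x, forall y, g y \in 0 :: pal S,
      proper_coloring (core_adj S) f & forall x y, att S x y -> f x != g y].

(** [bdry_lab_form] makes any boundary label adjacent to any reflected one. [side_forced] gives
    non-colourability of the join, and [side_crit] makes each edge between the boundaries
    critical. *)
Record valid_side (S : side) (K : nat) : Prop := ValidSide {
  core_adjC : symmetric (core_adj S);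
  core_adj_lab : forall x x', core_adj S x x' -> sadj (core_lab S x) (core_lab S x');
  att_lab : forall x y, att S x y -> sadj (core_lab S x) (bdry_lab S y);
  core_lab_ranged : forall x, ranged (core_lab S x);
  bdry_lab_form : forall y, exists2 a, (0 < a < 8)%N & bdry_lab S y = (a, 8, 9)%N;
  core_list_lt : forall x c, c \in core_list S x -> (c < K)%N;
  pal_lt : forall c, c \in pal S -> (0 < c < K)%N;
  side_forced : forall f g, side_coloring f g -> exists y : bdry S, g y = 0;
  side_crit : forall y0 : bdry S, exists f g, side_coloring f g /\
    forall y, (g y == 0) = (y == y0)
}.

Section Join.
Variables (S S' : side) (K : nat).
Hypothesis vS : valid_side S K.
Hypothesis vS' : valid_side S' K.
Hypothesis disj : forall c, c \in pal S -> c \notin pal S'.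

Definition join : finType := (core S + bdry S + (core S' + bdry S'))%type.

Definition side_adj (R : side) : rel (core R + bdry R) := fun u v =>
  match u, v with
  | inl x, inl x' => core_adj R x x'
  | inl x, inr y | inr y, inl x => att R x y
  | inr _, inr _ => false
  end.

Definition join_adj (u v : join) : bool :=
  match u, v with
  | inl u, inl v => side_adj u v
  | inr u, inr v => side_adj u v
  | inl (inr _), inr (inr _) | inr (inr _), inl (inr _) => true
  | _, _ => false
  end.

Definition join_lab (u : join) : triple :=
  match u with
  | inl (inl x) => core_lab S x
  | inl (inr y) => bdry_lab S y
  | inr (inl x) => reflect_label (core_lab S' x)
  | inr (inr y) => reflect_label (bdry_lab S' y)
  end.

Definition join_list (u : join) : seq nat :=
  match u with
  | inl (inl x) => core_list S x
  | inl (inr y) => 0 :: pal S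
  | inr (inl x) => core_list S' x
  | inr (inr y) => 0 :: pal S'
  end.

Lemma join_adjC : symmetric join_adj.
Proof.
by case=> [[x|y]|[x|y]] [[x'|y']|[x'|y']] //=; rewrite 1?(core_adjC vS) // 1?(core_adjC vS').
Qed.

Lemma bdry_lab_ranged (R : side) y : valid_side R K -> ranged (bdry_lab R y).
Proof. by move=> vR; have [a a08 ->] := bdry_lab_form vR y; rewrite /=; lia. Qed.

Lemma join_lab_ranged u : ranged (join_lab u).
Proof.
case: u => [[x|y]|[x|y]] /=; first exact: (core_lab_ranged vS).
- exact: bdry_lab_ranged.
- by apply: reflect_ranged; exact: (core_lab_ranged vS').
- by apply: reflect_ranged; exact: bdry_lab_ranged.
Qed.

Lemma join_adj_lab u v : join_adj u v -> sadj (join_lab u) (join_lab v).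
Proof.
have cross y y' : sadj (bdry_lab S y) (reflect_label (bdry_lab S' y')).
  have [a a8 ->] := bdry_lab_form vS y; have [b b8 ->] := bdry_lab_form vS' y'.
  by rewrite /sadj /sarc /=; lia.
have rS' := core_lab_ranged vS'.
have rb' y := bdry_lab_ranged y vS'.
case: u v => [[x|y]|[x|y]] [[x'|y']|[x'|y']] //= h; rewrite ?cross //.
- exact: (core_adj_lab vS).
- exact: (att_lab vS).
- by rewrite sadjC; apply: (att_lab vS).
- by apply: reflect_sadj => //; apply: (core_adj_lab vS').
- by apply: reflect_sadj => //; apply: (att_lab vS').
- by rewrite sadjC cross.
- by rewrite sadjC; apply: reflect_sadj => //; apply: (att_lab vS').
Qed.

Lemma join_not_list_colorable (f : join -> nat) :
  (forall u, f u \in join_list u) -> ~ proper_coloring join_adj f.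
Proof.
move=> fl fp.
have [|y y0] := @side_forced _ _ vS (fun x => f (inl (inl x))) (fun y => f (inl (inr y))).
  split=> [x|y|x x' xx'|x y xy]; [exact: (fl (inl (inl x)))|exact: (fl (inl (inr y)))| |].
    exact: (fp (inl (inl x)) (inl (inl x'))).
  exact: (fp (inl (inl x)) (inl (inr y))).
have [|y' y'0] := @side_forced _ _ vS' (fun x => f (inr (inl x))) (fun y => f (inr (inr y))).
  split=> [x|z|x x' xx'|x z xz]; [exact: (fl (inr (inl x)))|exact: (fl (inr (inr z)))| |].
    exact: (fp (inr (inl x)) (inr (inl x'))).
  exact: (fp (inr (inl x)) (inr (inr z))).
by have := fp (inl (inr y)) (inr (inr y')) isT; rewrite y0 y'0.
Qed.

(** Since the palettes are disjoint, 0 is the only colour that both boundaries can share, and it is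
    used once on each. *)
Lemma join_edge_critical y0 y0' : exists f : join -> nat,
  (forall u, f u \in join_list u) /\
  forall u v, join_adj u v -> f u = f v ->
    (u, v) = (inl (inr y0), inr (inr y0')) \/ (u, v) = (inr (inr y0'), inl (inr y0)).
Proof.
have [f [g [[fl gl fp fg] g0]]] := side_crit vS y0.
have [f' [g' [[fl' gl' fp' fg'] g0']]] := side_crit vS' y0'.
exists (fun u => match u with inl (inl x) => f x | inl (inr y) => g y
                            | inr (inl x) => f' x | inr (inr y) => g' y end); split.
  by case=> [[x|y]|[x|y]].
have gg y y' : g y = g' y' -> y = y0 /\ y' = y0'.
  move=> e; suff y00 : g y = 0.
    by split; apply/eqP; rewrite -?g0 -?g0' -?e y00.
  apply/eqP; have := gl y; rewrite inE => /orP[//|gp].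
  have := gl' y'; rewrite inE -e => /orP[//|]; by rewrite (negPf (disj gp)).
case=> [[x|y]|[x|y]] [[x'|y']|[x'|y']] //= h e.
- by have := fp _ _ h; rewrite e eqxx.
- by have := fg _ _ h; rewrite e eqxx.
- by have := fg _ _ h; rewrite e eqxx.
- by have [-> ->] := gg _ _ e; left.
- by have := fp' _ _ h; rewrite e eqxx.
- by have := fg' _ _ h; rewrite e eqxx.
- by have [-> ->] := gg _ _ (esym e); right.
- by have := fg' _ _ h; rewrite e eqxx.
Qed.

Lemma join_list_lt u c : (0 < K)%N -> c \in join_list u -> (c < K)%N.
Proof.
move=> K0; case: u => [[x|y]|[x|y]] /=; rewrite ?inE.
- exact: (core_list_lt vS).
- by case/orP=> [/eqP-> //|/(pal_lt vS)/andP[]].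
- exact: (core_list_lt vS').
- by case/orP=> [/eqP-> //|/(pal_lt vS')/andP[]].
Qed.

End Join.

(** The overhead w is the size of the palette and depends on K only, hence it is chosen before the
    sides. *)
Lemma join_critical (K : nat) : (0 < K)%N -> exists w, forall S S' : side,
  valid_side S K -> valid_side S' K ->
  (forall c, c \in pal S -> c \notin pal S') ->
  (0 < #|bdry S|)%N -> (0 < #|bdry S'|)%N ->
  exists G, [/\ nverts G = (#|core S| + #|bdry S| + (#|core S'| + #|bdry S'|) + w)%N,
    k_critical G K.+1, odd_girth_gt G 5 & (#|bdry S| * #|bdry S'| <= nedges G)%N].
Proof.
move=> K0; pose M := (2 ^ 2 ^ K + 18)%N.
exists #|palette K M| => S S' vS vS' disj /card_gt0P[y0 _] /card_gt0P[y0' _].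
have NM : (2 ^ 2 ^ K + 18 <= M)%N by [].
pose e := @list_adj K (join S S') (@join_adj S S') (@join_lab S S') (@join_list S S') M.
pose D : {set (join S S' + palette K M) * (join S S' + palette K M)} :=
  [set (inl (inl (inr p.1)), inl (inr (inr p.2))) | p : bdry S * bdry S'].
have DP x y : (x, y) \in D -> exists b b', x = inl (inl (inr b)) /\ y = inl (inr (inr b')).
  by case/imsetP=> -[b b'] _ [-> ->]; exists b, b'.
have jl u v := @join_adj_lab S S' K vS vS' u v.
have jr u := @join_lab_ranged S S' K vS vS' u.
have [||||||G [Gn Gc Gg GD]] := @critical_subgraph _ e K D; last first.
- exists G; split=> //; first by rewrite Gn !card_sum.
  apply: leq_trans GD; rewrite card_imset; last by move=> [? ?] [? ?] [-> ->].
  by rewrite card_prod.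
- move=> x y xyD; have [b [b' [-> ->]]] := DP _ _ xyD; split=> //.
  have [f [fl fe]] := join_edge_critical vS vS' disj b b'.
  have [F Fe] := @list_adj_complete K _ (@join_adj S S') (@join_lab S S') _ M f fl
    (fun u => join_list_lt vS vS' K0 (fl u)).
  exists F => u v uv Fuv; have [p [q [eu ev fpq]]] := Fe _ _ uv Fuv.
  move: uv; rewrite eu ev => pq.
  by have [[-> ->]|[-> ->]] := fe _ _ pq fpq; [left|right].
- by move=> x y xyD; have [b [b' [-> ->]]] := DP _ _ xyD; apply/imsetP=> -[[? ?] _].
- by apply/set0Pn; exists (inl (inl (inr y0)), inl (inr (inr y0'))); apply/imsetP; exists (y0, y0').
- move=> F Fp; have [f [fl fp]] := list_adj_sound NM jr Fp.
  exact: (join_not_list_colorable vS vS' fl fp).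
- exact: list_adj_no5 jl.
- exact/list_adjC/(join_adjC vS vS').
Qed.

(** * The odd cycle gadget *)

Section OddCycle.
Variable s : nat.
(** Odd, and at least 7 because the labels admit no closed walk of length 1, 3 or 5. *)
Definition qlen := (s.*2 + 7)%N.
Definition cyc : rel 'I_qlen := fun i j => (j == ordS i) || (i == ordS j).

Lemma cycC : symmetric cyc.
Proof. by move=> i j; rewrite /cyc orbC. Qed.

Lemma cyc_cases i j : cyc i j -> [\/ (j = i.+1 :> nat), (i = j.+1 :> nat),
  i = qlen.-1 :> nat /\ j = 0 :> nat | j = qlen.-1 :> nat /\ i = 0 :> nat].
Proof.
have st (a b : 'I_qlen) : b = ordS a ->
    b = a.+1 :> nat \/ a = qlen.-1 :> nat /\ b = 0 :> nat.
  move=> -> /=; have := ltn_ord a; rewrite leq_eqVlt => /orP[/eqP e|lt].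
    by right; split; [lia|rewrite e modnn].
  by left; rewrite modn_small.
case/orP=> /eqP /st [->|[-> ->]]; by [constructor 1|constructor 2|constructor 3|constructor 4].
Qed.

Lemma odd_cycle_not_2colorable (f : 'I_qlen -> nat) (a b : nat) :
  (forall i, (f i == a) || (f i == b)) -> ~ proper_coloring cyc f.
Proof.
move=> fab fp; have q0 : (0 < qlen)%N by rewrite /qlen; lia.
pose o : 'I_qlen := Ordinal q0.
have par n (nq : (n < qlen)%N) : (f (Ordinal nq) == f o) = ~~ odd n.
  elim: n nq => [|n IH] nq; first by rewrite (_ : Ordinal nq = o) ?eqxx //; apply: val_inj.
  have nq' := ltnW nq; have := IH nq'.
  have : cyc (Ordinal nq') (Ordinal nq).
    by apply/orP; left; apply/eqP/val_inj; rewrite /= modn_small.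
  move/fp; move: (fab (Ordinal nq)) (fab (Ordinal nq')) (fab o) => /=.
  by do 3 case/orP=> /eqP->; rewrite ?eqxx //= => h; lia.
have lq : (s.*2 + 6 < qlen)%N by rewrite /qlen; lia.
have /fp : cyc (Ordinal lq) o.
  apply/orP; left; apply/eqP/val_inj; rewrite /=.
  by rewrite (_ : _.+1 = qlen) ?modnn // /qlen; lia.
by rewrite par oddD odd_double.
Qed.

(** A 2-colouring of the cycle without i: parity of the position, switched before i. The switch
    repairs the closing edge, whose two ends have even positions. *)
Definition cut2 (i j : 'I_qlen) : bool := odd j (+) (j < i)%N.

Lemma cut2_proper i j j' : cyc j j' -> j != i -> j' != i -> cut2 i j != cut2 i j'.
Proof.
have oq : odd qlen.-1 = false by rewrite /qlen addnS /= oddD odd_double.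
have ltq := ltn_ord i.
have lt1 : (0 < qlen.-1)%N by rewrite /qlen; lia.
rewrite /cut2; case/cyc_cases=> [e|e|[e1 e2]|[e1 e2]]; rewrite -!val_eqE /= => h1 h2;
  [rewrite e|rewrite e|rewrite e1 e2 oq|rewrite e1 e2 oq] => /=; lia.
Qed.

(* A closed walk of length 7, after which the labels alternate between its ends. *)
Definition cyc_lab (n : nat) : triple :=
  nth (if odd n then (1, 2, 3) else (2, 3, 5))%N
    [:: (1, 2, 3); (2, 3, 4); (3, 4, 5); (4, 5, 6); (5, 6, 7); (3, 5, 6); (2, 3, 5)]%N n.

Lemma cyc_lab_sadj (i j : 'I_qlen) : cyc i j -> sadj (cyc_lab i) (cyc_lab j).
Proof.
have st n : sadj (cyc_lab n) (cyc_lab n.+1).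
  do 6 (case: n => [|n] //); rewrite /cyc_lab /= negbK !nth_nil.
  by case: n => [|n] //; rewrite /= nth_nil; case: odd.
have cl : sadj (cyc_lab qlen.-1) (cyc_lab 0).
  have -> : qlen.-1 = s.*2.+4.+2 by rewrite /qlen; lia.
  rewrite /cyc_lab; case: (s) => [|k] //.
  by rewrite doubleS /= nth_nil !negbK odd_double.
case/cyc_cases=> [->|->|[-> ->]|[-> ->]] //; rewrite sadjC //.
Qed.

Lemma cyc_lab_form n : exists a b c, cyc_lab n = (a, b, c) /\ (0 < a < b)%N /\ (b < c < 8)%N.
Proof.
rewrite /cyc_lab; do 7 (case: n => [|n]; first by do 3 eexists; split; [reflexivity|]).
by rewrite /= nth_nil; case: odd; do 3 eexists; split; try reflexivity.
Qed.

(* Boundary vertices get labels (a, 8, 9), which are adjacent to their reflections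
   (8, 9, 17 - b). *)
Definition up (t : triple) : triple := (t.1.2, t.2, 8)%N.
Definition up2 (t : triple) : triple := (t.2, 8, 9)%N.

(** * The or-gadget: some pendant vertex takes colour p *)

Section OrCore.
Variables (D : nat) (p : nat) (w : 'I_D -> nat).
Hypothesis p0 : (p != 0)%N.
Hypothesis winj : injective w.
Hypothesis wp : forall d, (w d != p)%N.
Hypothesis w0 : forall d, (w d != 0)%N.

Definition leaf : finType := ('I_qlen * 'I_D)%type.
Definition or_core : finType := ('I_qlen + leaf)%type.

Definition or_adj : rel or_core := fun x y =>
  match x, y with
  | inl i, inl j => cyc i j
  | inl i, inr l | inr l, inl i => l.1 == i
  | inr _, inr _ => false
  end.

Definition or_list (x : or_core) : seq nat :=
  match x with
  | inl _ => [:: 0, p & codom w]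
  | inr l => [:: p; w l.2]
  end.

Lemma or_adjC : symmetric or_adj.
Proof. by case=> [i|l] [j|l'] //=; exact: cycC. Qed.

(** If no leaf takes p, the leaves at each cycle vertex use all colours of [w], and the odd cycle is
    left with the two colours 0 and p. *)
Lemma or_forced (f : or_core -> nat) : (forall x, f x \in or_list x) ->
  proper_coloring or_adj f -> exists l, f (inr l) = p.
Proof.
move=> fl fp; case: (pickP (fun l : leaf => f (inr l) == p)) => [l /eqP|no]; first by exists l.
have fw l : f (inr l) = w l.2.
  by have := fl (inr l); rewrite !inE no => /eqP.
case: (@odd_cycle_not_2colorable (fun i => f (inl i)) 0 p).
  move=> i; have := fl (inl i); rewrite !inE orbA => /orP[//|/codomP[d e]].
  by have := fp (inl i) (inr (i, d)) (eqxx _); rewrite fw e eqxx.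
by move=> i j; apply: (fp (inl i) (inl j)).
Qed.

(** When only the leaf l0 takes p, its cycle vertex may use the colour [w l0.2], and the remaining
    path is 2-coloured by [cut2]. *)
Definition or_crit_col (l0 : leaf) (x : or_core) : nat :=
  match x with
  | inl i => if i == l0.1 then w l0.2 else if cut2 l0.1 i then p else 0
  | inr l => if l == l0 then p else w l.2
  end.

Lemma or_crit_list l0 x : or_crit_col l0 x \in or_list x.
Proof.
case: x => [i|l] /=; last by case: ifP; rewrite !inE eqxx ?orbT.
case: ifP => _; first by rewrite !inE codom_f !orbT.
by case: ifP; rewrite !inE eqxx ?orbT.
Qed.

Lemma or_crit_proper l0 : proper_coloring or_adj (or_crit_col l0).
Proof.
have il i l : l.1 == i -> or_crit_col l0 (inl i) != or_crit_col l0 (inr l).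
  move=> /eqP <- /=; have [->|ne] := altP (l =P l0); first by rewrite eqxx.
  have [e|_] := altP (l.1 =P l0.1); last by case: ifP => _; rewrite eq_sym.
  apply: contra_neq ne => /winj e2.
  by rewrite [l]surjective_pairing [l0]surjective_pairing e e2.
case=> [i|l] [j|l'] //=; [move=> ij|exact: il|move/il; by rewrite eq_sym].
rewrite /or_crit_col; have [ei|ni] := altP (i =P l0.1); have [ej|nj] := altP (j =P l0.1).
- case: (no5_irrefl sadj_no5 (cyc_lab i)).
  by have := cyc_lab_sadj ij; rewrite ei -ej => ->.
- by case: ifP.
- by case: ifP; rewrite eq_sym.
have := cut2_proper ij ni nj; case: (cut2 _ i); case: (cut2 _ j) => //= _.
by rewrite eq_sym.
Qed.
End OrCore.
End OddCycle.

(** * The two kinds of sides *)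

Section Sides.
Variable s : nat.
Local Notation q := (qlen s).

Lemma cyc_lab_ranged n : ranged (cyc_lab n).
Proof. by have [a [b [c [-> [h1 h2]]]]] := cyc_lab_form n; rewrite /=; lia. Qed.

Lemma up_ranged n : ranged (up (cyc_lab n)).
Proof. by have [a [b [c [-> [h1 h2]]]]] := cyc_lab_form n; rewrite /up /=; lia. Qed.

Lemma up2_ranged n : ranged (up2 (cyc_lab n)).
Proof. by have [a [b [c [-> [h1 h2]]]]] := cyc_lab_form n; rewrite /up2 /=; lia. Qed.

Lemma up_sadj n : sadj (cyc_lab n) (up (cyc_lab n)).
Proof.
have [a [b [c [-> [h1 h2]]]]] := cyc_lab_form n.
by rewrite /up /sadj /sarc /=; lia.
Qed.

Lemma up2_sadj n : sadj (up (cyc_lab n)) (up2 (cyc_lab n)).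
Proof.
have [a [b [c [-> [h1 h2]]]]] := cyc_lab_form n.
by rewrite /up /up2 /sadj /sarc /=; lia.
Qed.

Lemma up2_form n : exists2 a, (0 < a < 8)%N & up2 (cyc_lab n) = (a, 8, 9)%N.
Proof.
have [a [b [c [-> [h1 h2]]]]] := cyc_lab_form n.
by exists c => //; lia.
Qed.

Definition or_lab D (x : or_core s D) : triple :=
  match x with inl i => cyc_lab i | inr l => up (cyc_lab l.1) end.

Lemma or_adj_lab D (x x' : or_core s D) : or_adj x x' -> sadj (or_lab x) (or_lab x').
Proof.
case: x x' => [i|l] [j|l'] //=; first exact: cyc_lab_sadj.
  by move/eqP->; exact: up_sadj.
by move/eqP->; rewrite sadjC; exact: up_sadj.
Qed.

Lemma or_lab_ranged D (x : or_core s D) : ranged (or_lab x).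
Proof. by case: x => [i|l]; [exact: cyc_lab_ranged|exact: up_ranged]. Qed.

Section Matched.
Variables (D p K : nat) (w : 'I_D -> nat).
Hypothesis p0 : p != 0.
Hypothesis winj : injective w.
Hypothesis wp : forall d, w d != p.
Hypothesis w0 : forall d, w d != 0.
Hypothesis pK : (p < K)%N.
Hypothesis wK : forall d, (w d < K)%N.

(** The boundary is a copy of the leaves; the partner of a leaf coloured p loses p and keeps only
    0. *)
Definition matched_side : side := {|
  core := or_core s D;
  bdry := leaf s D;
  core_adj := @or_adj s D;
  att := fun x l => x == inr l;
  core_list := or_list p w;
  pal := [:: p];
  core_lab := @or_lab D;
  bdry_lab := fun l => up2 (cyc_lab l.1) |}.

Lemma matched_side_valid : valid_side matched_side K.
Proof.
have K0 : (0 < K)%N by lia.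
split=> /=.
- exact: or_adjC.
- exact: or_adj_lab.
- by move=> _ l /eqP->; exact: up2_sadj.
- exact: or_lab_ranged.
- by move=> l; exact: up2_form.
- case=> [i|l] c /=; rewrite !inE; last by case/orP=> /eqP->.
  by case/or3P=> [/eqP->|/eqP->|/codomP[d ->]].
- by move=> c; rewrite inE => /eqP->; rewrite lt0n p0.
- move=> f g [fl gl fp fg]; have [l fl0] := or_forced fl fp.
  exists l; have := gl l; rewrite !inE => /orP[/eqP//|/eqP gp].
  by have := fg (inr l) l (eqxx _); rewrite fl0 gp eqxx.
move=> l0; exists (or_crit_col p w l0), (fun l => if l == l0 then 0 else p); split; last first.
  by move=> l; case: ifP => //; rewrite (negPf p0).
split=> /=; first exact: or_crit_list.
- by move=> l; case: ifP; rewrite !inE eqxx ?orbT.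
- exact: or_crit_proper.
by move=> _ l /eqP-> /=; case: (l == l0).
Qed.

End Matched.

Section Product.
Variables (c1 c2 K : nat).
Hypothesis c10 : c1 != 0.
Hypothesis c20 : c2 != 0.
Hypothesis c12 : c1 != c2.
Hypothesis c1K : (c1 < K)%N.
Hypothesis c2K : (c2 < K)%N.

Let w (_ : 'I_1) := c2.
Let lf := leaf s 1.

(* The second or-gadget reaches the boundary through a path of length three,
   so that it can carry labels above 8. *)
Definition product_core : finType := (or_core s 1 + (or_core s 1 + (lf + lf)))%type.

Definition product_adj : rel product_core := fun x y =>
  match x, y with
  | inl x, inl y => or_adj x y
  | inr (inl x), inr (inl y) => or_adj x y
  | inr (inl (inr l)), inr (inr (inl l')) => l == l'
  | inr (inr (inl l)), inr (inl (inr l')) => l == l'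
  | inr (inr (inl l)), inr (inr (inr l')) => l == l'
  | inr (inr (inr l)), inr (inr (inl l')) => l == l'
  | _, _ => false
  end.

Definition product_att (x : product_core) (y : lf * lf) : bool :=
  match x with
  | inl (inr l) => l == y.1
  | inr (inr (inr l)) => l == y.2
  | _ => false
  end.

(** Along the path from a leaf of the second gadget the lists translate colour c1 into 0 and then
    into c2. The boundary vertex of two forced leaves thus loses both c1 and c2. *)
Definition product_list (x : product_core) : seq nat :=
  match x with
  | inl x | inr (inl x) => or_list c1 w x
  | inr (inr (inl _)) => [:: c1; 0]
  | inr (inr (inr _)) => [:: 0; c2]
  end.

(** A leaf of the second gadget borrows the label of the next cycle vertex, which saves [up] and
    [up2] for the two inner vertices of its path. *)
Definition next_lab (l : lf) : triple := cyc_lab (ordS l.1).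

Definition product_lab (x : product_core) : triple :=
  match x with
  | inl x => or_lab x
  | inr (inl (inl i)) => reflect_label (cyc_lab i)
  | inr (inl (inr l)) => reflect_label (next_lab l)
  | inr (inr (inl l)) => reflect_label (up (next_lab l))
  | inr (inr (inr l)) => reflect_label (up2 (next_lab l))
  end.

Definition product_side : side := {|
  core := product_core;
  bdry := (lf * lf)%type;
  core_adj := product_adj;
  att := product_att;
  core_list := product_list;
  pal := [:: c1; c2];
  core_lab := product_lab;
  bdry_lab := fun y => up2 (cyc_lab y.1.1) |}.

Lemma product_adj_lab x x' : product_adj x x' -> sadj (product_lab x) (product_lab x').
Proof.
have r := cyc_lab_ranged; have ru := up_ranged; have ru2 := up2_ranged.
have cn (i : 'I_q) (l : lf) : l.1 == i -> sadj (reflect_label (cyc_lab i)) (reflect_label (next_lab l)).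
  move/eqP=> <-; apply: reflect_sadj; [exact: r|exact: r|].
  have h : cyc (l.1 : 'I_q) (ordS l.1) by rewrite /cyc eqxx.
  exact: cyc_lab_sadj h.
have nu l : sadj (reflect_label (next_lab l)) (reflect_label (up (next_lab l))).
  by rewrite /next_lab; apply: reflect_sadj => //; exact: up_sadj.
have uu l : sadj (reflect_label (up (next_lab l))) (reflect_label (up2 (next_lab l))).
  by rewrite /next_lab; apply: reflect_sadj => //; exact: up2_sadj.
case: x x' => [x|[[i|l]|[l|l]]] [x'|[[i'|l']|[l'|l']]] //=.
- exact: or_adj_lab.
- by move=> h; apply: reflect_sadj => //; exact: cyc_lab_sadj.
- exact: cn.
- by rewrite sadjC; exact: cn.
- by move/eqP->.
- by move/eqP->; rewrite sadjC.
- by move/eqP->; exact: uu.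
- by move/eqP->; rewrite sadjC; exact: uu.
Qed.

Lemma product_adjC : symmetric product_adj.
Proof.
case=> [x|[[i|l]|[l|l]]] [x'|[[i'|l']|[l'|l']]] //=; rewrite 1?eq_sym //.
- exact: or_adjC.
- exact: cycC.
Qed.

Lemma product_side_valid : valid_side product_side K.
Proof.
have winj : injective w by move=> a b _; rewrite [a]ord1 [b]ord1.
have wp d : w d != c1 by rewrite /w eq_sym.
have w0 d : w d != 0 by [].
have K0 : (0 < K)%N by lia.
split=> /=.
- exact: product_adjC.
- exact: product_adj_lab.
- case=> [[i|l]|[[i|l]|[l|l]]] y //= /eqP->; first exact: up2_sadj.
  have [a a8 e1] := up2_form y.1.1; have [b b8 e] := up2_form (ordS y.2.1).
  change (sadj (reflect_label (up2 (cyc_lab (ordS y.2.1)))) (up2 (cyc_lab y.1.1))).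
  by rewrite e1 e /sadj /sarc /=; lia.
- case=> [x|[[i|l]|[l|l]]]; first exact: or_lab_ranged.
  + exact: reflect_ranged (cyc_lab_ranged i).
  + exact: reflect_ranged (cyc_lab_ranged (ordS l.1)).
  + exact: reflect_ranged (up_ranged (ordS l.1)).
  + exact: reflect_ranged (up2_ranged (ordS l.1)).
- by move=> y; exact: up2_form.
- have orK (x : or_core s 1) c : c \in or_list c1 w x -> (c < K)%N.
    case: x => [i|l] /=; rewrite !inE; last by case/orP=> /eqP->.
    by case/or3P=> [/eqP->|/eqP->|/codomP[d ->]].
  case=> [x|[x|[l|l]]] c /=; [exact: orK|exact: orK| |];
    by rewrite !inE => /orP[] /eqP->.
- by move=> c; rewrite !inE => /orP[] /eqP->; rewrite lt0n ?c10 ?c20.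
- move=> f g [fl gl fp fg].
  have [l1 e1] : exists l, f (inl (inr l)) = c1.
    apply: (@or_forced s 1 c1 w (fun x => f (inl x))) => [x|x y].
      exact: (fl (inl x)).
    exact: (fp (inl x) (inl y)).
  have [l2 e2] : exists l, f (inr (inl (inr l))) = c1.
    apply: (@or_forced s 1 c1 w (fun x => f (inr (inl x)))) => [x|x y xy].
      exact: (fl (inr (inl x))).
    by apply: (fp (inr (inl x)) (inr (inl y))); case: x y xy => [i|l] [i'|l'].
  have e3 : f (inr (inr (inl l2))) = 0.
    have := fl (inr (inr (inl l2))); rewrite !inE => /orP[/eqP e|/eqP//].
    by have := fp (inr (inl (inr l2))) (inr (inr (inl l2))) (eqxx _); rewrite e2 e eqxx.
  have e4 : f (inr (inr (inr l2))) = c2.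
    have := fl (inr (inr (inr l2))); rewrite !inE => /orP[/eqP e|/eqP//].
    by have := fp (inr (inr (inl l2))) (inr (inr (inr l2))) (eqxx _); rewrite e3 e eqxx.
  exists (l1, l2); have := gl (l1, l2); rewrite !inE => /or3P[/eqP//|/eqP e|/eqP e].
    by have := fg (inl (inr l1)) (l1, l2) (eqxx _); rewrite e1 e eqxx.
  by have := fg (inr (inr (inr l2))) (l1, l2) (eqxx _); rewrite e4 e eqxx.
move=> [l1 l2].
(* A boundary vertex takes c1 if its first leaf is not l1, else c2 if its second leaf is not l2;
   only (l1, l2) needs 0. *)
exists (fun x => match x with
  | inl x => or_crit_col c1 w l1 x
  | inr (inl x) => or_crit_col c1 w l2 x
  | inr (inr (inl l)) => if l == l2 then 0 else c1
  | inr (inr (inr l)) => if l == l2 then c2 else 0 end),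
 (fun y => if y.1 == l1 then if y.2 == l2 then 0 else c2 else c1); split; last first.
  move=> [a b]; rewrite xpair_eqE /=.
  by case: (a == l1); case: (b == l2); rewrite ?(negPf c10) ?(negPf c20).
split=> /=.
- case=> [x|[x|[l|l]]]; [exact: or_crit_list|exact: or_crit_list| |];
    by rewrite /=; case: ifP; rewrite !inE eqxx ?orbT.
- by move=> y; case: ifP => _; [case: ifP => _|]; rewrite !inE eqxx ?orbT.
- have xg l : or_crit_col c1 w l2 (inr l) != if l == l2 then 0 else c1.
    by rewrite /=; case: ifP => _ //; rewrite /w eq_sym.
  have gz l : (if l == l2 then 0 else c1) != (if l == l2 then c2 else 0).
    by case: ifP => _ //; rewrite eq_sym.
  have op l := or_crit_proper c10 winj wp w0 l.
  case=> [x|[[i|l]|[l|l]]] [x'|[[i'|l']|[l'|l']]] h //; try exact: op h.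
  1-4: move: h => /eqP->; by [exact: xg|exact: gz|rewrite eq_sym; exact: xg|rewrite eq_sym; exact: gz].
case=> [[i|l]|[[i|l]|[l|l]]] [a b] //= /eqP->; last first.
  by do 2 case: ifP => _; rewrite // 1?eq_sym.
by case: ifP => _; [case: ifP|rewrite eq_sym].
Qed.
End Product.
End Sides.

(** * Densities *)

Lemma card_leaf s D : #|leaf s D| = (qlen s * D)%N.
Proof. by rewrite card_prod !card_ord. Qed.

Lemma card_or_core s D : #|or_core s D| = (qlen s + qlen s * D)%N.
Proof. by rewrite card_sum card_leaf card_ord. Qed.

Lemma card_product_core s : #|product_core s| = (6 * qlen s)%N.
Proof. by rewrite !card_sum !card_leaf !card_ord; lia. Qed.

Lemma critical4_family : exists w, forall s, exists G,
  [/\ nverts G = (6 * qlen s + w)%N, k_critical G 4, odd_girth_gt G 5 &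
      (qlen s ^ 2 <= nedges G)%N].
Proof.
have [w hw] := @join_critical 3 isT; exists w => s.
have v1 : valid_side (@matched_side s 1 1 (fun=> 2)) 3.
  by apply: matched_side_valid => //; move=> a b _; rewrite [a]ord1 [b]ord1.
have v2 : valid_side (@matched_side s 1 2 (fun=> 1)) 3.
  by apply: matched_side_valid => //; move=> a b _; rewrite [a]ord1 [b]ord1.
have q0 : (0 < qlen s)%N by rewrite /qlen; lia.
have [|||G [Gn Gc Gg Ge]] := hw _ _ v1 v2.
- by move=> c /=; rewrite !inE => /eqP->.
- by rewrite card_leaf muln1.
- by rewrite card_leaf muln1.
exists G; split=> //.
  by rewrite Gn !card_or_core card_leaf; lia.
by move: Ge; rewrite !card_leaf muln1 mulnn.
Qed.

(** The palettes are {1, 2} and {3}. The matched side has two leaves per cycle vertex, blocking 1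
    and 2, hence 5 q' vertices, of which 2 q' are boundary. *)
Lemma critical5_family : exists w, forall s s', exists G,
  [/\ nverts G = (6 * qlen s + qlen s ^ 2 + 5 * qlen s' + w)%N, k_critical G 5,
      odd_girth_gt G 5 & (qlen s ^ 2 * (2 * qlen s') <= nedges G)%N].
Proof.
have [w hw] := @join_critical 4 isT; exists w => s s'.
have v1 : valid_side (product_side s 1 2) 4 by apply: product_side_valid.
have v2 : valid_side (@matched_side s' 2 3 (fun d => d.+1)) 4.
  apply: matched_side_valid => //.
  - by move=> a b [] /val_inj.
  - by move=> [[|[|[]]] ?].
  - by move=> [[|[|[]]] ?].
have q0 : (0 < qlen s)%N by rewrite /qlen; lia.
have q0' : (0 < qlen s')%N by rewrite /qlen; lia.
have cb : #|bdry (product_side s 1 2)| = (qlen s ^ 2)%N.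
  by rewrite card_prod !card_leaf !muln1 mulnn.
have [|||G [Gn Gc Gg Ge]] := hw _ _ v1 v2.
- by move=> c /=; rewrite !inE => /orP[] /eqP->.
- by rewrite cb expn_gt0 q0.
- by rewrite card_leaf; lia.
exists G; split=> //.
  by rewrite Gn cb card_or_core card_leaf card_product_core; lia.
by apply: leq_trans Ge; rewrite cb card_leaf (mulnC 2).
Qed.

Lemma critical_family K : (5 <= K)%N -> exists w, forall s, exists G,
  [/\ nverts G = (2 * (6 * qlen s + qlen s ^ 2) + w)%N, k_critical G K.+1,
      odd_girth_gt G 5 & (qlen s ^ 2 * qlen s ^ 2 <= nedges G)%N].
Proof.
move=> K5; have K0 : (0 < K)%N by lia.
have [w hw] := @join_critical K K0; exists w => s.
have v1 : valid_side (product_side s 1 2) K by apply: product_side_valid => //; lia.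
have v2 : valid_side (product_side s 3 4) K by apply: product_side_valid => //; lia.
have q0 : (0 < qlen s)%N by rewrite /qlen; lia.
have cb c1 c2 : #|bdry (product_side s c1 c2)| = (qlen s ^ 2)%N.
  by rewrite card_prod !card_leaf !muln1 mulnn.
have [|||G [Gn Gc Gg Ge]] := hw _ _ v1 v2.
- by move=> c /=; rewrite !inE => /orP[] /eqP->.
- by rewrite cb expn_gt0 q0.
- by rewrite cb expn_gt0 q0.
exists G; split=> //.
  by rewrite Gn !cb !card_product_core; lia.
by move: Ge; rewrite !cb.
Qed.

(** * From families of graphs to density constants *)

Local Open Scope ring_scope.

(** For positive c and r the square exceeds a^2 r^2 by at most a constant times r, which the gap (e
    - c a^2) r^2 absorbs for large r. *)
Lemma quadratic_eventually (R : realType) (c : R) (a b e : nat) : (0 < e)%N ->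
  c * (a ^ 2)%:R < e%:R ->
  exists r0 : nat, forall r, (r0 <= r)%N -> c * ((a * r + b) ^ 2)%:R < (e * r ^ 2)%:R.
Proof.
move=> e0 ce; have [c0|c0] := lerP c 0.
  exists 1%N => r r1; apply: (@le_lt_trans _ _ 0).
    by rewrite mulr_le0_ge0.
  by rewrite ltr0n muln_gt0 e0 expn_gt0 r1.
pose d := e%:R - c * (a ^ 2)%:R; have d0 : 0 < d by rewrite subr_gt0.
pose m : R := c * (2 * a * b + b ^ 2)%:R.
exists (Num.bound (m / d)).+1 => r r1.
have r0 : (0 < r)%N by lia.
have m0 : 0 <= m by rewrite mulr_ge0 // ltW.
have mr : m < d * r%:R.
  rewrite mulrC -ltr_pdivrMr //; apply: lt_le_trans (archi_boundP _) _.
    by rewrite divr_ge0 // ltW.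
  by rewrite ler_nat ltnW.
have le1 : ((a * r + b) ^ 2 <= a ^ 2 * r ^ 2 + (2 * a * b + b ^ 2) * r)%N.
  rewrite sqrnD expnMn -addnA leq_add2l mulnDl addnC; apply: leq_add.
    by rewrite leq_eqVlt; apply/orP; left; apply/eqP; ring.
  by rewrite leq_pmulr.
apply: (@le_lt_trans _ _ (c * (a ^ 2 * r ^ 2 + (2 * a * b + b ^ 2) * r)%:R)).
  by rewrite ler_wpM2l ?ler_nat // ltW.
rewrite natrD !natrM mulrDr -/m.
have -> : c * ((2 * a * b + b ^ 2)%:R * r%:R) = m * r%:R by rewrite /m mulrA.
have : m * r%:R < d * r%:R * r%:R by rewrite ltr_pM2r ?ltr0n.
rewrite /d !natrX; clear r1 le1 m0; clearbody m; nra.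
Qed.

(** The common factor g lets a vertex count quadratic in r be treated as g times a linear one; the
    limiting density is e / a^2. *)
Lemma dense_criticalI (R : realType) (k : nat) (c : R) (a b e : nat) : (0 < e)%N ->
  c * (a ^ 2)%:R < e%:R ->
  (forall N, exists r g G, [/\ (N <= r)%N, (r <= nverts G)%N, (0 < g)%N,
     k_critical G k & odd_girth_gt G 5] /\
     (nverts G <= g * (a * r + b))%N /\ (g ^ 2 * (e * r ^ 2) <= nedges G)%N) ->
  dense_critical 5 k c.
Proof.
move=> e0 ce fam N; have [r0 hr0] := quadratic_eventually b e0 ce.
have [r [g [G [[rN rn g0 Gc Gg] [Gn Ge]]]]] := fam (maxn N (maxn r0 1)).
exists G; split=> //; first by lia.
have g2 : (0 < g ^ 2)%N by rewrite expn_gt0 g0.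
apply: (@lt_le_trans _ _ ((g ^ 2 * (e * r ^ 2))%:R)); last by rewrite ler_nat.
have [c0|c0] := lerP c 0.
  apply: (@le_lt_trans _ _ 0); first by rewrite mulr_le0_ge0.
  by rewrite ltr0n muln_gt0 g2 muln_gt0 e0 expn_gt0; lia.
apply: (@le_lt_trans _ _ (c * ((g * (a * r + b)) ^ 2)%:R)).
  by rewrite ler_wpM2l ?(ltW c0) // ler_nat leq_exp2r.
rewrite expnMn natrM mulrCA [X in _ < X]natrM ltr_pM2l ?ltr0n //.
by apply: hr0; lia.
Qed.

Lemma dense_critical4 (R : realType) (c : R) : c < 1 / 36%:R -> dense_critical 5 4 c.
Proof.
move=> hc; have [w hw] := critical4_family.
apply: (@dense_criticalI _ _ _ 6 w 1) => //; first by rewrite -[(6 ^ 2)%N]/36%N; lra.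
move=> N; have [G [Gn Gc Gg Ge]] := hw N.
exists (qlen N), 1%N, G; rewrite Gn /qlen in Ge *; do !split=> //; lia.
Qed.

Lemma dense_critical5 (R : realType) : dense_critical 5 5 (3%:R / 35%:R : R).
Proof.
have [w hw] := critical5_family.
apply: (@dense_criticalI _ _ _ 50 (30 + w) 250) => //.
  by rewrite -[(50 ^ 2)%N]/2500%N; lra.
(* With r = 2N + 3 the cycle lengths are 5r and 5r^2, so both boundary parts are balanced: 50 r^2 +
   30 r + w vertices and 250 r^4 edges, of limiting density 1/10. *)
move=> N; have [G [Gn Gc Gg Ge]] := hw (5 * N + 4)%N (10 * N ^ 2 + 30 * N + 19)%N.
pose r := (N.*2 + 3)%N.
have q1 : qlen (5 * N + 4) = (5 * r)%N by rewrite /qlen /r; lia.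
have q2 : qlen (10 * N ^ 2 + 30 * N + 19) = (5 * r ^ 2)%N.
  by rewrite /qlen /r -!mulnn -!muln2; lia.
have rr : (r <= r * r)%N by rewrite leq_pmulr // /r; lia.
move: Gn Ge; rewrite q1 q2 => Gn Ge.
exists r, r, G; split; split=> //; rewrite ?Gn -?mulnn.
all: try nia.
all: rewrite /r; lia.
Qed.

Lemma dense_critical_ge6 (R : realType) (c : R) k : (6 <= k)%N -> c < 1 / 4%:R ->
  dense_critical 5 k c.
Proof.
case: k => // K K5 hc; have [w hw] := @critical_family K K5.
apply: (@dense_criticalI _ _ _ 2 (12 + w) 1) => //.
  by rewrite -[(2 ^ 2)%N]/4%N; lra.
move=> N; have [G [Gn Gc Gg Ge]] := hw N.
have qN : (N < qlen N)%N by rewrite /qlen; lia.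
exists (qlen N), (qlen N), G; move: (qlen N) qN Gn Ge => q qN Gn Ge.
split; split=> //; rewrite ?Gn ?mul1n //; [lia|nia|lia|nia].
Qed.

Lemma dense_critical_le (R : realType) (c : R) k : dense_critical 5 k c -> c <= 1 / 4%:R.
Proof.
move=> /(_ 1%N)[G [n1 _ Gg ce]]; rewrite leNgt; apply/negP=> hc.
have := mantel Gg; rewrite -(ler_nat R) natrM => h.
have n2 : 0 < (nverts G ^ 2)%:R :> R by rewrite ltr0n expn_gt0 n1.
by move: ce h; set x := (_ ^ 2)%:R in n2 *; set y := _%:R => ? ?; nra.
Qed.

(** [sup] is an upper bound only for a nonempty bounded set; Mantel supplies the bound. If the
    supremum were below A, the midpoint would belong to the set. *)
Lemma le_density_const (R : realType) k (A : R) :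
  (forall c : R, c < A -> dense_critical 5 k c) -> A <= density_const R 5 k.
Proof.
move=> hA; pose E := [set c : R | dense_critical 5 k c]%classic.
have supE : has_sup E.
  split; first by exists (A - 1); apply: hA; lra.
  by exists (1 / 4%:R) => c /dense_critical_le.
rewrite leNgt; apply/negP=> lt.
have : E ((density_const R 5 k + A) / 2%:R) by apply: hA; lra.
by move/(sup_upper_bound supE); rewrite -/(density_const R 5 k); lra.
Qed.

Theorem theorem2 (R : realType) :
  (exists c : R, 0 < c /\
     forall K : nat, exists (G : sgraph) (k : nat),
       [/\ (K <= k)%N, k_critical G k, odd_girth_gt G 5 &
           c * ((nverts G) ^ 2)%:R < (nedges G)%:R])
  /\ 1 / 36%:R <= density_const R 5 4
  /\ 3%:R / 35%:R <= density_const R 5 5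
  /\ (forall k : nat, (6 <= k)%N -> density_const R 5 k = 1 / 4%:R).
Proof.
split.
  (* Any positive constant below 1/4 serves all chromatic numbers from 6 on. *)
  exists (1 / 8%:R); split=> [|K]; first by lra.
  have K6 : (6 <= maxn 6 K)%N by exact: leq_maxl.
  have c8 : 1 / 8%:R < 1 / 4%:R :> R by lra.
  have [G [_ Gc Gg Ge]] := dense_critical_ge6 K6 c8 0%N.
  by exists G, (maxn 6 K); split=> //; exact: leq_maxr.
split; first by apply: le_density_const => c; exact: dense_critical4.
split.
  apply: le_density_const => c hc N; have [G [Gn Gc Gg Ge]] := dense_critical5 R N.
  exists G; split=> //; apply: le_lt_trans Ge.
  by rewrite ler_wpM2r // ltW.
move=> k k6; apply/eqP; rewrite eq_le; apply/andP; split; last first.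
  by apply: le_density_const => c; exact: dense_critical_ge6.
apply: ge_sup; last by move=> c /dense_critical_le.
exists 0; apply: dense_critical_ge6 => //; lra.
Qed.
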